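(* Let $X,Y$ be real Hilbert spaces, $K:X\to Y$ a bounded linear operator with adjoint $K^*$, and let $G:X\to\mathbb R$ and $F^*:Y\to\mathbb R$ be smooth convex functions with convexity constants $\gamma\ge 0$ and $\rho\ge 0$, respectively. Let $\widehat u=(\widehat x,\widehat y)$ be a saddle point of $\mathcal L(x,y)=G(x)+\langle Kx,y\rangle-F^*(y)$. Let $\phi,\psi,\theta:[0,\infty)\to(0,\infty)$ satisfy $\phi'(t)=2\gamma\theta(t)$, $\psi'(t)=2\rho\theta(t)$, $\theta'(t)=\theta(t)$, and let $(x(t),y(t),\zeta(t),\eta(t))$, $t\ge0$, be a smooth solution of $$\begin{cases}x'(t)=\zeta(t)-x(t),\\ y'(t)=\eta(t)-y(t),\\ \phi(t)\zeta'(t)=\theta(t)\left[\gamma(x(t)-\zeta(t))-\nabla G(x(t))-K^*\eta(t)\right],\\ \psi(t)\eta'(t)=\theta(t)\left[\rho(y(t)-\eta(t))-\nabla F^*(y(t))+K\zeta(t)\right].\end{cases}$$ Define $$\mathcal E(t)=\theta(t)\left[\widehat{\mathcal L}(x(t),\widehat y)-\widehat{\mathcal L}(\widehat x,y(t))\right]+\frac{\phi(t)}2\|\zeta(t)-\widehat x\|^2+\frac{\psi(t)}2\|\eta(t)-\widehat y\|^2 .$$ Then $\frac{\mathrm d}{\mathrm dt}\mathcal E(t)\le 0$ for all $t\ge0$, and consequently $\mathcal E(t)\le\mathcal E(0)$ for all $t\ge 0$, i.e. $$\theta(t)\left[\widehat{\mathcal L}(x(t),\widehat y)-\widehat{\mathcal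 L}(\widehat x,y(t))\right]+\frac{\phi(t)}2\|\zeta(t)-\widehat x\|^2+\frac{\psi(t)}2\|\eta(t)-\widehat y\|^2\le\mathcal E(0)\quad\forall\,t\ge0.$$
   Context: $F^*$ denotes the Fenchel conjugate of a proper lower semicontinuous convex function $F:Y\to(-\infty,+\infty]$. That $G$ has convexity constant $\gamma\ge0$ means $x\mapsto G(x)-\frac{\gamma}{2}\|x\|^2$ is convex; similarly for $F^*$ and $\rho$. A saddle point of $\mathcal L$ is $(\widehat x,\widehat y)$ with $\mathcal L(\widehat x,y)\le\mathcal L(\widehat x,\widehat y)\le\mathcal L(x,\widehat y)$ for all $(x,y)\in X\times Y$. The alternate Lagrangian is $$\widehat{\mathcal L}(x,y)=G(x)-\frac{\gamma}{2}\|x-\widehat x\|^2+\langle Kx,y\rangle-F^*(y)+\frac{\rho}{2}\|y-\widehat y\|^2 .$$ *)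

(* Defs.v *)
From HB Require Import structures.
From mathcomp Require Import all_boot all_order all_algebra.
From mathcomp Require Import sesquilinear.
From mathcomp Require Import all_classical all_reals all_analysis.

Set Implicit Arguments.
Unset Strict Implicit.
Unset Printing Implicit Defensive.

Import Order.TTheory GRing.Theory Num.Theory.
Import numFieldNormedType.Exports.

Local Open Scope classical_set_scope.
Local Open Scope ring_scope.

(* A real Hilbert space: a complete normed space whose norm comes from a
   (bilinear, symmetric, positive definite) scalar product. *)
HB.mixin Record CompleteNormedModule_isHilbert (R : realType) H
    of CompleteNormedModule R H := {
  inner : {dot H for idfun};
  inner_norm : forall x : H, inner x x = `|x| ^+ 2
}.

#[short(type="hilbertType")]
HB.structure Definition Hilbert (R : realType) :=
  {H of CompleteNormedModule_isHilbert R H & CompleteNormedModule R H}.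

Section Hilbert_notions.
Context {R : realType}.

Definition is_adjoint (X Y : hilbertType R) (K : X -> Y) (Kadj : Y -> X) :=
  forall x y, inner (K x) y = inner x (Kadj y).

(* [g] is the Riesz representative of the Frechet differential of [f] at [x]. *)
Definition is_gradient (X : hilbertType R) (f : X -> R) (x g : X) :=
  differentiable f x /\ forall v, 'd f x v = inner g v.

(* Smoothness of functions and of curves is read as C^1 throughout. *)
Definition smooth_with_gradient (X : hilbertType R) (f : X -> R)
    (gradf : X -> X) :=
  (forall x, is_gradient f x (gradf x)) /\ continuous gradf.

Definition has_convexity_constant (X : hilbertType R) (f : X -> R) (c : R) :=
  convex_function [set: X] (fun x => f x - c / 2 * `|x| ^+ 2).

Section extended_valued.
Context {Y : hilbertType R}.
Local Open Scope ereal_scope.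

Definition proper_function (F : Y -> \bar R) :=
  (forall y, F y != -oo) /\ exists y, F y != +oo.

(* On proper functions no sum below is of the form +oo - oo, and for t = 0 or
   t = 1 the convention 0 * +oo = 0 makes the inequality trivial. *)
Definition econvex_function (F : Y -> \bar R) :=
  forall (t : R) (y z : Y), (0 <= t <= 1)%R ->
    F (t *: y + (1 - t) *: z)%R <= t%:E * F y + (1 - t)%:E * F z.

Definition fenchel_conjugate (F : Y -> \bar R) (y : Y) : \bar R :=
  ereal_sup [set (inner z y)%:E - F z | z in [set: Y]].

End extended_valued.

(* Derivative of a curve defined on the half-line [0, +oo[; it is one-sided
   at t = 0, and values of [f] at negative times are irrelevant. *)
Definition has_derivative (V : normedModType R) (f : R -> V) (t : R) (l : V) :=
  (s - t)^-1 *: (f s - f t) @[s --> within `[0, +oo[ t^'] --> l.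

Definition smooth_curve (V : normedModType R) (f df : R -> V) :=
  (forall t, 0 <= t -> has_derivative f t (df t)) /\
  {within `[0, +oo[, continuous df}.

Section saddle_point_problem.
Context {X Y : hilbertType R}.

Definition lagrangian (G : X -> R) (K : X -> Y) (Fstar : Y -> R)
    (x : X) (y : Y) : R :=
  G x + inner (K x) y - Fstar y.

Definition saddle_point (L : X -> Y -> R) (xhat : X) (yhat : Y) :=
  forall x y, L xhat y <= L xhat yhat /\ L xhat yhat <= L x yhat.

Definition alt_lagrangian (G : X -> R) (K : X -> Y) (Fstar : Y -> R)
    (gamma rho : R) (xhat : X) (yhat : Y) (x : X) (y : Y) : R :=
  G x - gamma / 2 * `|x - xhat| ^+ 2 + inner (K x) y
  - Fstar y + rho / 2 * `|y - yhat| ^+ 2.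

Definition lyapunov (G : X -> R) (K : X -> Y) (Fstar : Y -> R)
    (gamma rho : R) (xhat : X) (yhat : Y) (phi psi theta : R -> R)
    (x : R -> X) (y : R -> Y) (zeta : R -> X) (eta : R -> Y) (t : R) : R :=
  let Lhat := alt_lagrangian G K Fstar gamma rho xhat yhat in
  theta t * (Lhat (x t) yhat - Lhat xhat (y t))
  + phi t / 2 * `|zeta t - xhat| ^+ 2 + psi t / 2 * `|eta t - yhat| ^+ 2.

End saddle_point_problem.
End Hilbert_notions.

(* Main.v *)
(* Differentiating E and substituting the equations of the flow, every term
   involving K, zeta or eta cancels and what is left is
     E' = theta [G x - G xhat + gamma/2 |x - xhat|^2 - <grad G x, x - xhat>]
        + theta [F* y - F* yhat + rho/2 |y - yhat|^2 - <grad F* y, y - yhat>],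
   where both brackets are nonpositive by the first-order characterization of
   strong convexity. Monotonicity of E then follows from the mean value theorem,
   the derivative being two-sided at positive times. *)

Require Import Defs.
From HB Require Import structures.
From mathcomp Require Import all_boot all_order all_algebra.
From mathcomp Require Import sesquilinear.
From mathcomp Require Import all_classical all_reals all_analysis.
From mathcomp Require Import ring lra.

Set Implicit Arguments.
Unset Strict Implicit.
Unset Printing Implicit Defensive.

Import Order.TTheory GRing.Theory Num.Theory.
Import numFieldNormedType.Exports.

Local Open Scope classical_set_scope.
Local Open Scope ring_scope.

(** * Algebra and continuity of the inner product *)

Section inner_product.
Context {R : realType} {H : hilbertType R}.
Implicit Types u v w : H.

Lemma innerC u v : inner u v = inner v u.
Proof. by rewrite hermC expr0 mul1r. Qed.

Lemma innerDl w u v : inner (u + v) w = inner u w + inner v w.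
Proof. exact: linearDl. Qed.

Lemma innerDr w u v : inner w (u + v) = inner w u + inner w v.
Proof. by rewrite innerC innerDl !(innerC w). Qed.

Lemma innerNl u v : inner (- u) v = - inner u v.
Proof. exact: linearNl. Qed.

Lemma innerNr u v : inner u (- v) = - inner u v.
Proof. by rewrite innerC innerNl innerC. Qed.

Lemma innerZl a u v : inner (a *: u) v = a * inner u v.
Proof. exact: linearZl_LR. Qed.

Lemma innerZr a u v : inner u (a *: v) = a * inner u v.
Proof. by rewrite innerC innerZl innerC. Qed.

Definition innerE := (innerDl, innerDr, innerNl, innerNr, innerZl, innerZr).

Lemma inner_polarization u v :
  inner u v = (`|u + v| ^+ 2 - `|u - v| ^+ 2) / 4.
Proof. by rewrite -!inner_norm !innerE (innerC v u); field. Qed.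

(** Polarization reduces joint continuity of [inner] to continuity of the norm, so no Cauchy-Schwarz
    estimate is required. *)
Lemma cvg_inner (T : Type) (F : set_system T) (FF : Filter F)
    (f g : T -> H) u v :
  f s @[s --> F] --> u -> g s @[s --> F] --> v ->
  inner (f s) (g s) @[s --> F] --> inner u v.
Proof.
move=> fu gv; rewrite inner_polarization.
under eq_fun do rewrite inner_polarization.
rewrite !expr2; under eq_fun do rewrite !expr2.
by apply: cvgMl; apply: cvgB; apply: cvgM; apply: cvg_norm;
  (exact: cvgD || exact: cvgB).
Qed.

End inner_product.

(** * Calculus of derivatives on the closed half-line, one-sided at 0 *)

Section has_derivative_theory.
Context {R : realType}.
Implicit Types (V : normedModType R) (H : hilbertType R) (t : R).

Lemma near_half_line_neq t :
  \forall s \near within `[0, +oo[ t^', s != t.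
Proof.
rewrite near_withinE; near=> s => _; near: s; exact: nbhs_dnbhs_neq.
Unshelve. all: by end_near. Qed.

(** Away from [t], [f s] is [f t] plus [s - t] times the slope; the first factor tends to 0 and the
    slope to [l]. *)
Lemma has_derivative_cvg V (f : R -> V) t l :
  has_derivative f t l -> f s @[s --> within `[0, +oo[ t^'] --> f t.
Proof.
move=> fl; rewrite -[f t]addr0 -(scale0r l).
have st : s - t @[s --> within `[0, +oo[ t^'] --> (0 : R).
  rewrite -(subrr t); apply: cvgB; last exact: cvg_cst.
  by apply: cvg_within_filter; exact: nbhs_dnbhs.
apply: cvg_trans (cvgD (cvg_cst (f t)) (cvgZ st fl)).
apply: near_eq_cvg; near=> s => /=.
have st0 : s - t != 0 by rewrite subr_eq0; near: s; exact: near_half_line_neq.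
by rewrite addrfctE scalerA divff// scale1r addrC subrK.
Unshelve. all: by end_near. Qed.

Lemma has_derivative_cst V (v : V) t : has_derivative (fun=> v) t 0.
Proof.
rewrite /has_derivative; under eq_fun do rewrite subrr scaler0.
exact: cvg_cst.
Qed.

Lemma has_derivative_line V (u v : V) t :
  has_derivative (fun s => u + s *: v) t v.
Proof.
rewrite /has_derivative.
apply: (cvg_trans _ (cvg_cst v (F := within `[0, +oo[ t^'))).
apply: near_eq_cvg; near=> s => /=.
have st0 : s - t != 0 by rewrite subr_eq0; near: s; exact: near_half_line_neq.
by rewrite opprD addrACA subrr add0r -scalerBl scalerA mulVf// scale1r.
Unshelve. all: by end_near. Qed.

Lemma has_derivativeD V (f g : R -> V) t l m :
  has_derivative f t l -> has_derivative g t m ->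
  has_derivative (fun s => f s + g s) t (l + m).
Proof.
move=> fl gm; rewrite /has_derivative.
under eq_fun do rewrite opprD addrACA scalerDr.
exact: cvgD.
Qed.

Lemma has_derivativeN V (f : R -> V) t l :
  has_derivative f t l -> has_derivative (fun s => - f s) t (- l).
Proof.
move=> fl; rewrite /has_derivative.
under eq_fun do rewrite -opprD scalerN.
exact: cvgN.
Qed.

Lemma has_derivativeB V (f g : R -> V) t l m :
  has_derivative f t l -> has_derivative g t m ->
  has_derivative (fun s => f s - g s) t (l - m).
Proof. by move=> fl gm; exact/has_derivativeD/has_derivativeN. Qed.

Lemma has_derivativeM (f g : R -> R) t l m :
  has_derivative f t l -> has_derivative g t m ->
  has_derivative (fun s => f s * g s) t (l * g t + f t * m).
Proof.
move=> fl gm; rewrite /has_derivative.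
have -> : (fun s => (s - t)^-1 *: (f s * g s - f t * g t)) =
    (fun s => ((s - t)^-1 *: (f s - f t)) * g s +
       f t * ((s - t)^-1 *: (g s - g t))).
  by apply/funext => s; rewrite /GRing.scale/=; ring.
apply: cvgD; first by apply: cvgM => //; exact: has_derivative_cvg gm.
by apply: cvgM => //; exact: cvg_cst.
Qed.

Lemma has_derivative_inner H (f g : R -> H) t l m :
  has_derivative f t l -> has_derivative g t m ->
  has_derivative (fun s => inner (f s) (g s)) t (inner l (g t) + inner (f t) m).
Proof.
move=> fl gm; rewrite /has_derivative.
have -> : (fun s => (s - t)^-1 *: (inner (f s) (g s) - inner (f t) (g t))) =
    (fun s => inner ((s - t)^-1 *: (f s - f t)) (g s) +
       inner (f t) ((s - t)^-1 *: (g s - g t))).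
  by apply/funext => s; rewrite !innerE /GRing.scale/=; ring.
apply: cvgD; first by apply: cvg_inner => //; exact: has_derivative_cvg gm.
by apply: cvg_inner => //; exact: cvg_cst.
Qed.

Lemma has_derivative_normsqr H (f : R -> H) t l :
  has_derivative f t l ->
  has_derivative (fun s => `|f s| ^+ 2) t (2 * inner l (f t)).
Proof.
move=> fl; under eq_fun do rewrite -inner_norm.
rewrite mulr_natl mulr2n [X in _ + X]innerC.
exact: has_derivative_inner.
Qed.

Lemma has_derivative_normsqrB H (f : R -> H) t l v :
  has_derivative f t l ->
  has_derivative (fun s => `|f s - v| ^+ 2) t (2 * inner l (f t - v)).
Proof.
move=> fl; apply: has_derivative_normsqr; rewrite -[l]subr0.
exact/has_derivativeB/has_derivative_cst.
Qed.

(** Chain rule along a curve: the slope of [f \o c] is [inner g] of the slope of [c], plus the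
    Frechet remainder divided by [s - t]. The latter vanishes because the slopes of [c] stay
    bounded. *)
Lemma has_derivative_gradient H (f : H -> R) (c : R -> H) t l g :
  is_gradient f (c t) g -> has_derivative c t l ->
  has_derivative (fun s => f (c s)) t (inner g l).
Proof.
move=> [df dfE] cl; rewrite /has_derivative.
have cB0 : c s - c t @[s --> within `[0, +oo[ t^'] --> (0 : H).
  rewrite -(subrr (c t)); apply: cvgB; last exact: cvg_cst.
  exact: has_derivative_cvg cl.
have slopeE s : (s - t)^-1 *: (f (c s) - f (c t)) =
   inner g ((s - t)^-1 *: (c s - c t)) +
   (s - t)^-1 *: (f (c s) - f (c t) - 'd f (c t) (c s - c t)).
  by rewrite dfE innerZr /GRing.scale/=; ring.
under eq_fun do rewrite slopeE.
rewrite -[inner g l]addr0; apply: cvgD.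
  by apply: cvg_inner => //; exact: cvg_cst.
apply/cvgr0Pnorm_le => e e0.
(* The slopes of [c] are eventually shorter than [|l| + 1], which is positive even if [l = 0]. A
   remainder below [e / (|l| + 1)] times [|c s - c t|] is then at most [e] after division by
   [s - t]. *)
have l1 : 0 < `|l| + 1 by rewrite ltr_wpDl.
have slope_lt : \forall s \near within `[0, +oo[ t^',
    `|(s - t)^-1 *: (c s - c t)| < `|l| + 1.
  by apply: (cvgr_lt `|l|); [exact: cvg_norm|rewrite ltrDl].
have /eqaddoP/(_ _ (divr_gt0 e0 l1)) small := diff_locally df.
have {}small : \forall s \near within `[0, +oo[ t^',
    `|f (c s) - f (c t) - 'd f (c t) (c s - c t)| <=
      e / (`|l| + 1) * `|c s - c t|.
  move: (cB0 _ small); rewrite /nbhs/=; apply: filterS => s /=.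
  by rewrite !fctE /= subrK opprD addrA.
apply: filterS2 slope_lt small => s slope_s.
rewrite normrZ => small_s.
apply: le_trans (ler_wpM2l (normr_ge0 _) small_s) _.
rewrite mulrCA -normrZ -mulrA ler_piMr ?(ltW e0)// mulrC.
by rewrite ler_pdivrMr// mul1r ltW.
Qed.

(** Turns a derivative at 0 into a limit from the right, along which inequalities valid for small
    [s > 0] pass to the limit. *)
Lemma cvg_at_right_half_line : 0^'+ --> within `[0, +oo[ (0 : R)^'.
Proof.
move=> A; rewrite /nbhs/= /at_right /dnbhs /within/= /prop_near1.
apply: (@filterS _ (nbhs (0 : R))) => s /= sA s0; apply: sA.
  by rewrite gt_eqF.
by rewrite in_itv/= ltW.
Qed.

Lemma has_derivative_is_derive (f : R -> R) t l :
  0 < t -> has_derivative f t l -> is_derive t 1 f l.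
Proof.
move=> t0 fl.
have shift_cvg : h + t @[h --> 0^'] --> within `[0, +oo[ t^'.
  move=> A tA.
  (* As [t > 0], all points near [t] lie in the half-line, so the restriction to it is harmless and
     the limit is two-sided. *)
  have near_t : \forall s \near t, 0 < s /\ (s != t -> s \in `[0, +oo[ -> A s).
    near=> s; split; near: s; first exact: lt_nbhsr.
    exact: tA.
  have ht : h + t @[h --> (0 : R)] --> t.
    rewrite -[X in _ --> X]add0r.
    by apply: cvgD; [exact: cvg_id|exact: cvg_cst].
  have := ht _ near_t; rewrite /nbhs/= /dnbhs /within/= /prop_near1.
  apply: (@filterS _ (nbhs (0 : R))) => h [ht0 hA] h0; apply: hA.
    by rewrite -subr_eq0 addrK.
  by rewrite in_itv/= andbT ltW.
have slope_cvg : (fun h => h^-1 *: (f (h *: 1 + t) - f t)) @ 0^' --> l.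
  have := cvg_comp _ _ shift_cvg fl.
  apply: cvg_trans; apply: near_eq_cvg; near=> h => /=.
  by rewrite addrK /GRing.scale/= mulr1.
by apply: DeriveDef; [apply/cvg_ex; exists l|exact: cvg_lim].
Unshelve. all: by end_near. Qed.

Lemma has_derivative_within_continuous V (f df : R -> V) :
  (forall t, 0 <= t -> has_derivative f t (df t)) ->
  {within `[0, +oo[, continuous f}.
Proof.
move=> fdf; apply/subspace_continuousP => t; rewrite /= in_itv/= andbT => t0.
move=> B ftB; have := has_derivative_cvg (fdf _ t0) ftB.
rewrite /nbhs/= /dnbhs /within/= /prop_near1.
apply: (@filterS _ (nbhs t)) => s /= sB s0.
(* The punctured filter says nothing about [s = t]; there [B] contains [f t], being a neighbourhood
   of it. *)
have [->|st] := eqVneq s t; first exact: nbhs_singleton.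
exact: sB.
Qed.

(** The sign of the derivative is used only at positive times; continuity up to 0 extends the
    comparison to the endpoint. *)
Lemma has_derivative_le0_nincr (f df : R -> R) :
  (forall t, 0 <= t -> has_derivative f t (df t)) ->
  (forall t, 0 <= t -> df t <= 0) -> forall t, 0 <= t -> f t <= f 0.
Proof.
move=> fdf df0 t t0.
have fD u (u0 : 0 < u) := has_derivative_is_derive u0 (fdf u (ltW u0)).
apply: (@ler0_derive1_nincry _ _ 0) => // [u|u|].
- by rewrite in_itv/= andbT => /fD[].
- rewrite in_itv/= andbT => u0.
  by rewrite derive1E (@derive_val _ _ _ _ _ _ _ (fD _ u0)) df0// ltW.
- exact: has_derivative_within_continuous fdf.
Qed.

End has_derivative_theory.

(** * First-order lower bound for strongly convex functions *)

Section convexity.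
Context {R : realType} {H : hilbertType R}.

(** The convex function obtained by subtracting [c / 2] times the squared norm lies above its
    tangent at [x]; expanding the squares restores the quadratic term in [z - x]. *)
Lemma convexity_constant_gradient_le (f : H -> R) (c : R) (x z g : H) :
  has_convexity_constant f c -> is_gradient f x g ->
  f x + inner g (z - x) + c / 2 * `|z - x| ^+ 2 <= f z.
Proof.
move=> fc fg.
pose h w := f w - c / 2 * `|w| ^+ 2.
pose line (s : R) := x + s *: (z - x).
have line0 : line 0 = x by rewrite /line scale0r addr0.
have dline : has_derivative line 0 (z - x) by exact: has_derivative_line.
have dh : has_derivative (h \o line) 0 (inner g (z - x) - c * inner x (z - x)).
  have fg' : is_gradient f (line 0) g by rewrite line0.
  have := has_derivativeB (has_derivative_gradient fg' dline)
    (has_derivativeM (has_derivative_cst (c / 2) 0)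
      (has_derivative_normsqr dline)).
  by rewrite mul0r add0r mulrA divfK// line0 (innerC (z - x)).
(* The difference quotients of the convex function [h] along the segment from
   [x] to [z] are bounded by [h z - h x]; let the parameter tend to [0+]. *)
suff : inner g (z - x) - c * inner x (z - x) <= h z - h x.
  rewrite /h -!inner_norm !innerE (innerC z x); lra.
have dhr := cvg_trans (cvg_app _ cvg_at_right_half_line) dh.
apply: cvgr_to_le dhr _; near=> s.
have s0 : 0 < s by near: s; exact: nbhs_right_gt.
have s1 : s <= 1 by near: s; exact: nbhs_right_le.
(* The weight [s] goes to [z], so that the convex combination is the point [line s]. *)
have := fc (Itv01 (ltW s0) s1) z x (mem_setT _) (mem_setT _).
have lineE : line s = s *: z + (1 - s) *: x.
  by rewrite /line scalerBr scalerBl scale1r addrCA.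
rewrite convRE /= -[conv _ _ _]/(s *: z + (1 - s) *: x) -lineE /unstable.onem.
rewrite -/(h _) -/(h z) -/(h x) => fcs.
rewrite subr0 line0 [_ *: _]/(_ * _) ler_pdivrMl//; lra.
Unshelve. all: by end_near. Qed.

End convexity.

Theorem theorem4p1 (R : realType) (X Y : hilbertType R)
    (K : {linear X -> Y}) (Kadj : Y -> X)
    (K_bounded : continuous K) (K_adjoint : is_adjoint K Kadj)
    (G : X -> R) (gradG : X -> X)
    (F : Y -> \bar R) (Fstar : Y -> R) (gradFstar : Y -> Y)
    (gamma rho : R)
    (F_proper : proper_function F) (F_lsc : lower_semicontinuous F)
    (F_convex : econvex_function F)
    (FstarE : forall y, (Fstar y)%:E = fenchel_conjugate F y)
    (G_smooth : smooth_with_gradient G gradG)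
    (Fstar_smooth : smooth_with_gradient Fstar gradFstar)
    (G_convex : convex_function [set: X] G)
    (Fstar_convex : convex_function [set: Y] Fstar)
    (gamma_ge0 : 0 <= gamma) (rho_ge0 : 0 <= rho)
    (G_gamma : has_convexity_constant G gamma)
    (Fstar_rho : has_convexity_constant Fstar rho)
    (xhat : X) (yhat : Y)
    (uhat_saddle : saddle_point (lagrangian G K Fstar) xhat yhat)
    (phi psi theta : R -> R)
    (phi_gt0 : forall t, 0 <= t -> 0 < phi t)
    (psi_gt0 : forall t, 0 <= t -> 0 < psi t)
    (theta_gt0 : forall t, 0 <= t -> 0 < theta t)
    (phi' : forall t, 0 <= t -> has_derivative phi t (2 * gamma * theta t))
    (psi' : forall t, 0 <= t -> has_derivative psi t (2 * rho * theta t))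
    (theta' : forall t, 0 <= t -> has_derivative theta t (theta t))
    (x dx zeta dzeta : R -> X) (y dy eta deta : R -> Y)
    (x_smooth : smooth_curve x dx) (y_smooth : smooth_curve y dy)
    (zeta_smooth : smooth_curve zeta dzeta) (eta_smooth : smooth_curve eta deta)
    (x_eq : forall t, 0 <= t -> dx t = zeta t - x t)
    (y_eq : forall t, 0 <= t -> dy t = eta t - y t)
    (zeta_eq : forall t, 0 <= t -> phi t *: dzeta t =
      theta t *: (gamma *: (x t - zeta t) - gradG (x t) - Kadj (eta t)))
    (eta_eq : forall t, 0 <= t -> psi t *: deta t =
      theta t *: (rho *: (y t - eta t) - gradFstar (y t) + K (zeta t))) :
  let E := lyapunov G K Fstar gamma rho xhat yhat
             phi psi theta x y zeta eta in
  (forall t, 0 <= t -> exists2 dE, has_derivative E t dE & dE <= 0) /\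
  (forall t, 0 <= t -> E t <= E 0).
Proof.
move=> E.
have [dG _] := G_smooth; have [dF _] := Fstar_smooth.
have [x' _] := x_smooth; have [y' _] := y_smooth.
have [zeta' _] := zeta_smooth; have [eta' _] := eta_smooth.
pose dE t := theta t *
  (G (x t) - G xhat + gamma / 2 * `|x t - xhat| ^+ 2
     - inner (gradG (x t)) (x t - xhat)
   + (Fstar (y t) - Fstar yhat + rho / 2 * `|y t - yhat| ^+ 2
     - inner (gradFstar (y t)) (y t - yhat))).
have E' t : 0 <= t -> has_derivative E t (dE t).
  move=> t0.
  have Gx' := has_derivative_gradient (dG (x t)) (x' _ t0).
  have Fy' := has_derivative_gradient (dF (y t)) (y' _ t0).
  (* By adjointness the coupling term is the inner product of [x] with the constant [Kadj yhat]. *)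
  have Kx' := has_derivative_inner (x' _ t0) (has_derivative_cst (Kadj yhat) t).
  have Ky' := has_derivative_inner (has_derivative_cst (K xhat) t) (y' _ t0).
  have c (a : R) := has_derivative_cst a t.
  (* Constant terms, even the zero ones such as the squared norm of [yhat - yhat], are kept so that
     the assembled function matches the unfolded [lyapunov]. *)
  have Lx' := has_derivativeD (has_derivativeB (has_derivativeD
    (has_derivativeB Gx' (has_derivativeM (c (gamma / 2))
      (has_derivative_normsqrB (v := xhat) (x' _ t0)))) Kx')
    (c (Fstar yhat))) (c (rho / 2 * `|yhat - yhat| ^+ 2)).
  have Ly' := has_derivativeD (has_derivativeB (has_derivativeD
    (c (G xhat - gamma / 2 * `|xhat - xhat| ^+ 2)) Ky') Fy')
    (has_derivativeM (c (rho / 2))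
      (has_derivative_normsqrB (v := yhat) (y' _ t0))).
  have zeta2' := has_derivativeM (has_derivativeM (phi' t t0) (c 2^-1))
    (has_derivative_normsqrB (v := xhat) (zeta' _ t0)).
  have eta2' := has_derivativeM (has_derivativeM (psi' t t0) (c 2^-1))
    (has_derivative_normsqrB (v := yhat) (eta' _ t0)).
  have := has_derivativeD (has_derivativeD (has_derivativeM (theta' t t0)
    (has_derivativeB Lx' Ly')) zeta2') eta2'.
  rewrite /E /lyapunov /alt_lagrangian.
  under [X in _ -> has_derivative X _ _]eq_fun do
    rewrite [inner (K (x _)) _]K_adjoint.
  congr has_derivative.
  rewrite /dE x_eq// y_eq//.
  (* Differentiating the two squared distances yields [phi t] times
     [inner (dzeta t) (zeta t - xhat)] and its analogue for [eta]; pairing the flow equations with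
     these vectors evaluates both. *)
  have := congr1 (fun v => inner v (zeta t - xhat)) (zeta_eq t t0).
  have := congr1 (fun v => inner v (eta t - yhat)) (eta_eq t t0).
  (* Expand everything into inner products in one normal form, with [Kadj] eliminated in favour of
     [K] and symmetric pairs in a fixed order. The identity is then linear in the resulting
     monomials. *)
  rewrite -!inner_norm !innerE !(innerC (Kadj _)) -!K_adjoint.
  rewrite (linear0r inner) (linear0l inner).
  rewrite (innerC xhat (x t)) (innerC xhat (zeta t)) (innerC (zeta t) (x t)).
  rewrite (innerC yhat (y t)) (innerC yhat (eta t)) (innerC (eta t) (y t)).
  lra.
have dE_le0 t : 0 <= t -> dE t <= 0.
  move=> t0; rewrite /dE pmulr_rle0 ?theta_gt0//.
  (* The tangents are taken at the moving points [x t] and [y t] and compared with the values at the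
     saddle point, so each bracket of [dE t] is nonpositive. *)
  have := convexity_constant_gradient_le xhat G_gamma (dG (x t)).
  have := convexity_constant_gradient_le yhat Fstar_rho (dF (y t)).
  rewrite -(opprB (x t)) -(opprB (y t)) !normrN !innerNr; lra.
split=> [t t0|]; first by exists (dE t); [exact: E'|exact: dE_le0].
exact: has_derivative_le0_nincr E' dE_le0.
Qed.
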